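(* In the geometric amoebot model with reconfigurable circuits, assume that all amoebots of the connected amoebot structure share a common chirality. There is a protocol that aligns the compasses of all amoebots (i.e. afterwards all $n$ amoebots have the same compass orientation) after $O(\log n)$ rounds, with high probability.
   Context: Amoebot model with circuits. $G_{eqt}=(V,E)$ is the infinite regular triangular grid graph. A set of $n$ amoebots occupies a finite set $S\subseteq V$ of nodes, $|S|=n$, exactly one amoebot per node of $S$; the induced graph $G_S=G_{eqt}|_S$ is connected; amoebots do not move. Amoebots on adjacent nodes are neighbors and are joined by a bond. All amoebots are anonymous and run the same randomized finite state machine (constant memory, independent of $n$). Each amoebot has a compass orientation (one of the six grid directions, which it regards as its reference direction; it may redefine it by rotating its compass by multiples of $60^\circ$) and a chirality (which sense of rotation it regards as clockwise), and labels its incident edges accordingly. Initially the compass orientations are arbitrary. Every edge incident to an amoebot carries the same constant number ($\ge 2$) of pins in a fixed linear order; the pins on a bond are shared by the two neighbors; each amoebot labels the pins of an edge in order according to its own chirality, so two neighbors label the shared pins in opposite orders iff they have the same chirality. Each amoebot chooses a pin configuration: an arbitrary set of undirected wires between pins on its own incident edges. If $P$ is the set of all pins and $C$ the set of all wires, a circuit is a connected component of the graph $(P,C)$; an amoebot is part of a circuit iff the circuit contains a pin on one of its bonds. Time proceeds in synchronous rounds; in each round every amoebot reads its memory and the beeps received on its circuits, computes and updates its memory, and then may reconfigure its wires and send a beep on any of its circuits. A beep sent on a circuit is received in the next round by all amoebots of that circuit; an amoebot only learns whether at least one beep was sent on the circuit, not the origin nor the number of senders. Running time is the number of rounds. With high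 probability: with probability at least $1-1/n^c$ where the constant $c$ can be made arbitrarily large. *)

(* Defs.v *)
From HB Require Import structures.
From mathcomp Require Import all_boot all_order all_algebra.
From mathcomp Require Import finmap.

Set Implicit Arguments.
Unset Strict Implicit.
Unset Printing Implicit Defensive.

Import GRing.Theory.
Local Open Scope ring_scope.

(* Nodes of the infinite triangular grid, in axial coordinates: (x, y) stands
   for the point x * e_0 + y * e_60 of the plane, where e_a is the unit vector
   of angle a degrees. *)
Notation node := (int * int)%type.

(* d : dir is the direction of angle 60 * d degrees (counterclockwise);
   'Z_6 also serves for the labels of the six edges of an amoebot. *)
Notation dir := 'Z_6.

Definition dirvec (d : dir) : node :=
  nth (0, 0) [:: (1, 0); (0, 1); (-1, 1); (-1, 0); (0, -1); (1, -1)] d.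

Definition grid_adj (u v : node) : bool := [exists d : dir, v == u + dirvec d].

Definition structure_connected (S : {fset node}) : Prop :=
  forall u v : S, connect (fun x y : S => grid_adj (val x) (val y)) u v.

(* A chirality is [true] if the sense of rotation the amoebot regards as
   clockwise is the true clockwise one.  [rotate chi d e] is the direction
   obtained from d by a rotation of e * 60 degrees in the sense regarded as
   clockwise.  In particular, the edge labelled e by an amoebot with chirality
   chi and compass orientation o points to [rotate chi o e]. *)
Definition rotate (chi : bool) (d e : dir) : dir := if chi then d - e else d + e.

(* Pins as labelled by an amoebot: (label of the edge, rank of the pin). The
   ranks increase in the sense of rotation the amoebot regards as clockwise. *)
Notation pin k := (dir * 'I_k)%type.

(* A randomized finite state machine, for k pins per edge.  In a round, the
   amoebot passes from the memory state q to q' := step q r x, where r tells on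
   which pins a beep was received and x is drawn uniformly from [coin].  It then
   rotates its compass by [turn q'] * 60 degrees (in its own clockwise sense),
   sets up the wires [wire q'] (read as undirected) and beeps on the circuits
   of the pins in [beep q']; these pins are labelled w.r.t. the new compass. *)
Record protocol (k : nat) := Protocol {
  state : finType;
  init : state;
  coin : finType;
  coin_gt0 : (0 < #|coin|)%N;
  step : state -> {ffun pin k -> bool} -> coin -> state;
  turn : state -> dir;
  wire : state -> rel (pin k);
  beep : state -> pred (pin k)
}.

Record amoebot (k : nat) (A : protocol k) := Amoebot {
  memory : state A;
  compass : dir;
  received : {ffun pin k -> bool}
}.

Section Model.

Variables (k : nat) (A : protocol k) (S : {fset node}) (chi : S -> bool).

Definition config := S -> amoebot A.

(* A pin on a bond has two names, one from each neighbor; [same_pin] relates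
   them.  The neighbors rank the pins of the bond in opposite orders iff they
   have the same chirality. *)
Definition pin_name : finType := (S * pin k)%type.

Section Circuits.

Variable g : config.

Definition edge_dir (x : pin_name) : dir :=
  rotate (chi x.1) (compass (g x.1)) x.2.1.

Definition on_bond (x : pin_name) : bool :=
  val x.1 + dirvec (edge_dir x) \in S.

Definition same_pin (x y : pin_name) : bool :=
  [&& val y.1 == val x.1 + dirvec (edge_dir x),
      val x.1 == val y.1 + dirvec (edge_dir y)
    & y.2.2 == (if chi x.1 == chi y.1 then rev_ord x.2.2 else x.2.2)].

Definition wired (x y : pin_name) : bool :=
  (x.1 == y.1) && (wire (memory (g x.1)) x.2 y.2 || wire (memory (g x.1)) y.2 x.2).

Definition same_circuit : rel pin_name :=
  connect (fun x y => same_pin x y || wired x y).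

Definition part_of (u : S) (x : pin_name) : bool :=
  [exists y : pin_name, [&& y.1 == u, on_bond y & same_circuit x y]].

(* If the sender is not part of the circuit, then that circuit consists of pins
   of the sender on edges to unoccupied nodes, and nobody is part of it. *)
Definition beeping (x : pin_name) : bool :=
  [exists y : pin_name, same_circuit x y && beep (memory (g y.1)) y.2].

Definition reception (u : S) : {ffun pin k -> bool} :=
  [ffun p => part_of u (u, p) && beeping (u, p)].

End Circuits.

Definition initial (o : S -> dir) : config :=
  fun u => Amoebot (init A) (o u) [ffun=> false].

(* The first half of a round: every amoebot computes, rotates its compass, and
   thereby sets its wires and beeps; [received] is then updated by [round]. *)
Definition activate (g : config) (w : {ffun S -> coin A}) : config :=
  fun u => let a := g u in
  let q := step (memory a) (received a) (w u) in
  Amoebot q (rotate (chi u) (compass a) (turn q)) (received a).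

Definition round (g : config) (w : {ffun S -> coin A}) : config :=
  let h := activate g w in
  fun u => Amoebot (memory (h u)) (compass (h u)) (reception h u).

Definition run (o : S -> dir) (w : seq {ffun S -> coin A}) : config :=
  foldl round (initial o) w.

(* The random choices of all amoebots during the first T rounds. *)
Definition choices (T : nat) : finType := T.-tuple {ffun S -> coin A}.

(* All amoebots have one and the same compass orientation from the end of round
   t0 on, up to the end of round T. *)
Definition aligned_from (o : S -> dir) (t0 T : nat) (w : choices T) : bool :=
  [exists d : dir, forall t : 'I_T.+1, (t0 <= t)%N ==>
    [forall u : S, compass (run o (take t w) u) == d]].

End Model.

Definition Pr (W : finType) (E : pred W) : rat := #|E|%:R / #|W|%:R.

(* Main.v *)
Require Import Defs.
From HB Require Import structures.
From mathcomp Require Import all_boot all_order all_algebra.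
From mathcomp Require Import finmap.
From mathcomp Require Import ring zify.

(* Call a maximal connected set of amoebots with equal compasses a region.
   Neighbors can compare their compasses by announcing edge labels, so every
   region can be wired into one circuit.  Initially every amoebot is a
   candidate.  In a phase of 15 rounds every candidate tosses a coin; a region
   has heads if one of its candidates does, in which case its candidates with
   tails retire.  A region without heads next to one with heads adopts the
   compass of one of these and all its candidates retire.  Thus every region
   always has a candidate.  As long as there are two regions, a candidate u has
   a candidate v in an adjacent region, and retires if u tosses tails and v
   heads, be its own region heads or not.  So the expected number of candidates
   shrinks by a factor 3/4 per phase, and by Markov's inequality the compasses
   are aligned after O(log n) phases with high probability.  Once aligned, no
   amoebot ever turns. *)

Set Implicit Arguments.
Unset Strict Implicit.
Unset Printing Implicit Defensive.

Import Order.TTheory GRing.Theory Num.Theory.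

(** * Sums over random sequences, and iterated drift *)

Section SeqSum.

Variable X : finType.

(** Up to the factor [#|X| ^ n], the expectation of [F] over [n] independent uniform draws. Plain
    sequences in place of tuples make it easy to split a run into phases. *)
Fixpoint seqsum n (F : seq X -> nat) : nat :=
  if n is n'.+1 then \sum_x seqsum n' (fun s => F (x :: s)) else F [::].

Lemma seqsumS n F : seqsum n.+1 F = \sum_x seqsum n (fun s => F (x :: s)).
Proof. by []. Qed.

Lemma sum_tuple n (F : seq X -> nat) : \sum_(w : n.-tuple X) F w = seqsum n F.
Proof.
elim: n F => [|n IH] F /=.
  rewrite (big_pred1 [tuple]) // => w; exact/esym/eqP/tuple0.
rewrite (reindex (fun p : X * n.-tuple X => cons_tuple p.1 p.2)) /=; last first.
  exists (fun w => (thead w, behead_tuple w)) => [[x w] _|w _] /=.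
    by congr (_, _); apply/val_inj.
  by rewrite [RHS]tuple_eta; apply/val_inj.
rewrite -(pair_bigA _ (fun x (w : n.-tuple X) => F (x :: w))) /=.
by apply: eq_bigr => x _; exact: (IH (fun s => F (x :: s))).
Qed.

Lemma leq_seqsum n F G :
  (forall s, size s = n -> F s <= G s) -> seqsum n F <= seqsum n G.
Proof.
elim: n F G => [|n IH] F G FG /=; first exact: FG.
by apply: leq_sum => x _; apply: IH => s sn; apply: FG; rewrite /= sn.
Qed.

Lemma eq_seqsum n F G :
  (forall s, size s = n -> F s = G s) -> seqsum n F = seqsum n G.
Proof.
by move=> FG; apply/anti_leq/andP; split; apply: leq_seqsum => s /FG ->.
Qed.

Lemma seqsum_mull n a F : seqsum n (fun s => a * F s) = a * seqsum n F.
Proof.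
elim: n F => [|n IH] F //=.
by rewrite big_distrr /=; apply: eq_bigr => x _; rewrite IH.
Qed.

Lemma seqsum_const n a : seqsum n (fun=> a) = #|X| ^ n * a.
Proof.
elim: n => [|n IH] /=; first by rewrite mul1n.
by rewrite IH sum_nat_const expnS mulnA.
Qed.

Lemma seqsum_cat m n F :
  seqsum (m + n) F = seqsum m (fun s => seqsum n (fun s' => F (s ++ s'))).
Proof. by elim: m F => [|m IH] F //=; apply: eq_bigr => x _; rewrite IH. Qed.

Variables (G : Type) (step : G -> X -> G) (ok : G -> Prop) (phi : G -> nat).
Variables (L a b : nat).

Hypothesis ok_phase : forall g w, ok g -> size w = L -> ok (foldl step g w).
Hypothesis drift_phase : forall g, ok g ->
  a * seqsum L (fun w => phi (foldl step g w)) <= b * (#|X| ^ L * phi g).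

(** Condition on the first phase: the induction hypothesis bounds the remaining phases from the
    configuration it reaches, and the one-phase drift bounds the average of [phi] there. *)
Lemma drift_phases m g : ok g ->
  a ^ m * seqsum (m * L) (fun w => phi (foldl step g w))
    <= b ^ m * (#|X| ^ (m * L) * phi g).
Proof.
elim: m g => [|m IH] g okg; first by rewrite /= !mul1n.
rewrite mulSn seqsum_cat expnSr -mulnA mulnCA -seqsum_mull.
set lhs := (X in X <= _).
have le1 : lhs <= a * seqsum L (fun w =>
    b ^ m * #|X| ^ (m * L) * phi (foldl step g w)).
  rewrite leq_mul2l; apply/orP; right; apply: leq_seqsum => w wL.
  rewrite -mulnA; apply: leq_trans (IH _ (ok_phase okg wL)).
  rewrite leq_mul2l; apply/orP; right; apply: leq_seqsum => w' _.
  by rewrite foldl_cat.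
apply: leq_trans le1 _; rewrite seqsum_mull mulnCA.
apply: leq_trans (leq_mul (leqnn _) (drift_phase okg)) _.
by rewrite expnD expnSr; apply/eq_leq; ring.
Qed.

End SeqSum.

(** Of the four equally likely outcomes of the coins of [u] and [v], exactly one is excluded. The
    complement is counted as a product of the values allowed at each point. *)
Lemma card_ffun_bool2 (V : finType) (u v : V) : u != v ->
  4 * #|[pred y : {ffun V -> bool} | ~~ (~~ y u && y v)]|
    = 3 * #|{ffun V -> bool}|.
Proof.
move=> uv; set P := [pred y : _ | _].
pose F w : pred bool := [pred c | ((w == u) ==> ~~ c) && ((w == v) ==> c)].
have PF : [predC P] =i family F.
  move=> y; rewrite !inE negbK; apply/andP/familyP => [[yu yv] w|H].
    by rewrite inE; apply/andP; split; apply/implyP => /eqP ->.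
  by split; [have := H u | have := H v]; rewrite inE eqxx //= => /andP [].
have F1 w : w != u -> w != v -> #|F w| = 2.
  move=> /negPf wu /negPf wv; rewrite -card_bool; apply: eq_card => c.
  by rewrite !inE wu wv.
have Fu : #|F u| = 1.
  rewrite -(card1 false); apply: eq_card => c.
  by rewrite !inE eqxx (negPf uv) andbT; case: c.
have Fv : #|F v| = 1.
  rewrite -(card1 true); apply: eq_card => c.
  by rewrite !inE eqxx eq_sym (negPf uv); case: c.
have cN : #|{ffun V -> bool}| = 4 * #|[predC P]|.
  rewrite (eq_card PF) card_family foldrE big_map big_enum /=.
  rewrite (bigD1 u) //= (bigD1 v) 1?eq_sym //= Fu Fv !mul1n.
  rewrite (eq_bigr (fun=> 2)) => [|w /andP [wu wv]]; last exact: F1.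
  rewrite card_ffun card_bool -prod_nat_const (bigD1 u) //=.
  by rewrite (bigD1 v) 1?eq_sym //= mulnA.
have := cardC P; rewrite cN; move: #|P| #|[predC P]| => p q; lia.
Qed.

Local Open Scope fset_scope.
Local Open Scope ring_scope.

(** * Arithmetic of directions and rotations *)

Lemma dir33 : 3 + 3 = 0 :> dir.
Proof. exact/val_inj. Qed.

Lemma dirvecD3 (d : dir) : dirvec (d + 3) = - dirvec d.
Proof. by case: d => [[|[|[|[|[|[|]]]]]]]. Qed.

Lemma dirvec_inj : injective dirvec.
Proof.
by move=> [[|[|[|[|[|[|]]]]]] i] // [[|[|[|[|[|[|]]]]]] j] //= H; apply/val_inj.
Qed.

Lemma rotate0 b d : rotate b d 0 = d.
Proof. by case: b; rewrite /rotate ?subr0 ?addr0. Qed.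

Lemma rotate_inj b d : injective (rotate b d).
Proof. by case: b => t t' /addrI // /oppr_inj. Qed.

Lemma rotate_surj b d d' : exists t, d' = rotate b d t.
Proof.
case: b; [exists (d - d') | exists (d' - d)]; rewrite /rotate.
  by rewrite subKr.
by rewrite addrC subrK.
Qed.

(* If the bond labelled e by u is labelled e' by its neighbor v, then
   the compass of v is that of u rotated by t = e - e' + 3, i.e. e' = e - t + 3. *)
Lemma opposite_label b (d d' e t : dir) :
  (rotate b d' (e - t + 3) == rotate b d e + 3) = (d' == rotate b d t).
Proof.
have E (x z : dir) : (x == z) = (x - z == 0) by rewrite subr_eq0.
rewrite [LHS]E [RHS]E; case: b => /=; congr (_ == _).
  transitivity (d' - (d - t) - (3 + 3)); first by ring.
  by rewrite dir33 subr0.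
by ring.
Qed.

Section Connect.

Variables (T U : finType) (e : rel T) (e' : rel U) (f : T -> U) (P : pred T).

Hypothesis eP : forall x y, P x -> e x y -> P y /\ connect e' (f x) (f y).

(** Serves to confine a circuit to a set of pins and to project it onto the structure. *)
Lemma connect_image x y :
  P x -> connect e x y -> P y /\ connect e' (f x) (f y).
Proof.
move=> Px /connectP [p pth ->] {y}.
elim: p x Px pth => [|z p IH] x Px /=; first by split.
case/andP=> /(eP Px) [Pz xz] /(IH z Pz) [Py zy].
by split=> //; apply: connect_trans zy.
Qed.

End Connect.

(** * One phase of merging on an abstract graph *)

(* A phase starts with compasses [o] and candidates [c], who toss [y]. *)
Section Merge.

Variables (V : finType) (adj : rel V) (b : bool).
Hypothesis adj_sym : symmetric adj.

Definition region (o : V -> dir) : rel V :=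
  connect (fun u v => adj u v && (o u == o v)).

Section Phase.

Variables (o : V -> dir) (c : V -> bool) (y : V -> bool).

Definition heads u := [exists v, region o u v && (c v && y v)].

Definition facing u d :=
  ~~ heads u && [exists v, adj u v && heads v && (o v == rotate b (o u) d)].

Definition hit u d := [exists v, region o u v && facing v d].

(** The default [0] means that the region does not turn; by [hit0] it is never itself hit. As [pick]
    depends only on the predicate, a whole region makes the same choice. *)
Definition target u : dir := odflt 0 [pick d | hit u d].

Definition next_compass u := rotate b (o u) (target u).

Definition next_cand u := [&& c u, heads u ==> y u & target u == 0].

Lemma region_sym u v : region o u v = region o v u.
Proof.
apply: sym_connect_sym => {}u {}v.
by rewrite adj_sym eq_sym.
Qed.

Lemma region_compass u v : region o u v -> o u = o v.
Proof.
move=> /connectP [p pth ->] {v}.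
by elim: p u pth => //= w p IH u /andP [/andP [_ /eqP ->]] /IH.
Qed.

Lemma region_closed u v w : region o u v -> region o u w = region o v w.
Proof. by move=> uv; apply: (same_connect _ uv); exact: region_sym. Qed.

Lemma heads_region u v : region o u v -> heads u = heads v.
Proof. by move=> uv; apply: eq_existsb => w; rewrite (region_closed w uv). Qed.

Lemma hit_region u v : region o u v -> hit u =1 hit v.
Proof.
by move=> uv d; apply: eq_existsb => w; rewrite (region_closed w uv).
Qed.

Lemma target_region u v : region o u v -> target u = target v.
Proof. by move=> uv; rewrite /target (eq_pick (hit_region uv)). Qed.

Lemma hitP u d : hit u d -> ~~ heads u /\ exists v w,
  [/\ region o u v, adj v w, heads w & o w = rotate b (o v) d].
Proof.
case/existsP=> v /andP [uv /andP [hv /existsP [w]]].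
move=> /andP [/andP [vw hw] /eqP E].
split; first by rewrite (heads_region uv).
by exists v, w.
Qed.

(** A neighbor with an equal compass lies in the same region, so it cannot have heads when [u] has
    none. *)
Lemma hit0 u : ~~ hit u 0.
Proof.
apply/negP => /hitP [hu [v [w [uv vw hw]]]]; rewrite rotate0 => E.
case/negP: hu; rewrite (heads_region uv) (@heads_region v w) //.
by apply: connect1; rewrite vw E eqxx.
Qed.

Lemma target_hit u d : hit u d -> hit u (target u).
Proof. by rewrite /target; case: pickP => //= ->. Qed.

Lemma target_neq0 u d : hit u d -> target u != 0.
Proof. by move/target_hit; apply: contraTneq => ->; exact: hit0. Qed.

Lemma target_heads u : heads u -> target u = 0.
Proof.
by move=> hu; rewrite /target; case: pickP => //= d /hitP []; rewrite hu.
Qed.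

Lemma next_compass_aligned d u : (forall v, o v = d) -> next_compass u = d.
Proof.
move=> od; suff: target u = 0.
  by rewrite /next_compass => ->; rewrite rotate0.
rewrite /target; case: pickP => //= t ht.
have [_ [v [w [_ _ _]]]] := hitP ht.
rewrite !od -{1}(rotate0 b d) => /rotate_inj t0.
by move: ht; rewrite -t0 (negbTE (hit0 u)).
Qed.

Lemma region_next u v : region o u v -> region next_compass u v.
Proof.
apply: connect_sub => {}u {}v /andP [uv /eqP E]; apply: connect1.
rewrite uv /next_compass E (@target_region u v) ?eqxx //.
by apply: connect1; rewrite uv E eqxx.
Qed.

(** A region with heads keeps a candidate who tossed them; a region that turns joins one with heads,
    which stays put; any other region keeps all its candidates. *)
Lemma next_cand_region :
  (forall u, exists2 v, region o u v & c v) ->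
  forall u, exists2 v, region next_compass u v & next_cand v.
Proof.
move=> inv u.
have hcand v : heads v -> exists2 w, region next_compass v w & next_cand w.
  move=> hv; case/existsP: (hv) => w /and3P [vw cw yw].
  exists w; first exact: region_next.
  by rewrite /next_cand cw yw implybT -(target_region vw) target_heads.
have [/hcand //|hu] := boolP (heads u).
have [t0|tn0] := eqVneq (target u) 0.
  have [v uv cv] := inv u.
  exists v; first exact: region_next.
  rewrite /next_cand cv -(heads_region uv) (negbTE hu).
  by rewrite -(target_region uv) t0.
have : hit u (target u).
  by move: tn0; rewrite /target; case: pickP => //=; rewrite eqxx.
case/hitP=> _ [v [w [uv vw hw E]]].
have [z wz cz] := hcand w hw; exists z => //.
apply: connect_trans (region_next uv) _; apply: connect_trans wz.
apply: connect1; rewrite vw /next_compass (target_heads hw) rotate0 E.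
by rewrite (target_region uv) eqxx.
Qed.

End Phase.

(** By connectivity some edge leaves the region of [u]; take a candidate [v] in the region at its
    far end. If [u] has tails and [v] heads, then [u] retires by its own toss if its region has
    heads, and otherwise because its region turns. That [v] is chosen before [y] is what allows
    counting tosses. *)
Lemma next_cand_witness (o : V -> dir) (c : V -> bool) u w :
  (forall v z, connect adj v z) ->
  (forall v, exists2 z, region o v z & c z) -> o u != o w ->
  exists2 v, v != u &
    forall y : V -> bool, ~~ y u -> y v -> ~~ next_cand o c y u.
Proof.
move=> conn inv uw.
have /existsP [a /existsP [a' /and3P [ua aa' ua']]] :
    [exists a, exists a', [&& region o u a, adj a a' & ~~ region o u a']].
  apply: contraR uw => /existsPn H; apply/eqP.
  have cl v z : region o u v -> adj v z -> region o u z.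
    move=> uv vz; move: (H v) => /existsPn /(_ z).
    by rewrite uv vz /= negbK.
  apply: (@region_compass o).
  have reg p v : region o u v -> path adj v p -> region o u (last v p).
    by elim: p v => //= z p IH v /cl + /andP [vz]; move=> /(_ z vz) /IH.
  by have /connectP [p pth ->] := conn u w; apply: reg pth; exact: connect0.
have [v a'v cv] := inv a'.
exists v.
  by apply: contraNneq ua' => vu; rewrite region_sym -vu.
move=> y yu yv; rewrite /next_cand (negbTE yu) implybF.
have [hu|hu] := boolP (heads o c y u); first by rewrite andbF.
have ha' : heads o c y a' by apply/existsP; exists v; rewrite a'v cv yv.
have [d Ed] := rotate_surj b (o a) (o a').
have hd : hit o c y u d.
  apply/existsP; exists a; rewrite ua /facing -(heads_region c y ua) hu /=.
  by apply/existsP; exists a'; rewrite aa' ha' Ed eqxx.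
by rewrite (negbTE (target_neq0 hd)) !andbF.
Qed.

End Merge.

(** * What is received on the circuits *)

Definition adjacent (S : {fset node}) (u v : S) := grid_adj (val u) (val v).

Lemma adjacent_sym (S : {fset node}) : symmetric (@adjacent S).
Proof.
move=> u v; apply/existsP/existsP => -[d /eqP E]; exists (d + 3);
  by rewrite dirvecD3 E addrK.
Qed.

Section Reception.

Variables (k : nat) (A : protocol k.+2) (S : {fset node}).
Variables (chi : S -> bool) (b : bool) (o : S -> dir).
Hypothesis chiE : forall u, chi u = b.

Definition across (u : S) (e : dir) (v : S) :=
  val v == val u + dirvec (rotate b (o u) e).

Lemma across_uniq u e v w : across u e v -> across u e w -> v = w.
Proof. by move=> /eqP uv /eqP uw; apply: val_inj; rewrite uv uw. Qed.

Lemma adjacentP u v : reflect (exists e, across u e v) (adjacent u v).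
Proof.
apply: (iffP existsP) => [[d /eqP uv]|[e uv]]; last by eexists; exact: uv.
by have [e de] := rotate_surj b (o u) d; exists e; rewrite /across uv de.
Qed.

Lemma across_opposite u e v : across u e v ->
  exists2 e', across v e' u & rotate b (o v) e' = rotate b (o u) e + 3.
Proof.
move=> /eqP uv; have [e' ee'] := rotate_surj b (o v) (rotate b (o u) e + 3).
by exists e' => //; rewrite /across -ee' dirvecD3 uv addrK.
Qed.

Definition inner (u : S) (e : dir) := [exists v, across u e v && (o v == o u)].

Local Notation reg := (region (@adjacent S) o).

Variable h : config A S.
Hypothesis compassE : forall u, compass (h u) = o u.

Lemma same_pinE (x y : pin_name k.+2 S) : same_pin chi h x y =
  [&& across x.1 x.2.1 y.1, across y.1 y.2.1 x.1 & y.2.2 == rev_ord x.2.2].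
Proof. by rewrite /same_pin /edge_dir !chiE !compassE eqxx. Qed.

Lemma same_pin_sym : symmetric (same_pin chi h).
Proof.
move=> x y; rewrite !same_pinE andbCA; do 2! congr (_ && _).
by rewrite -(inj_eq rev_ord_inj) rev_ordK eq_sym.
Qed.

Lemma same_pin_label (x y : pin_name k.+2 S) : same_pin chi h x y ->
  rotate b (o y.1) y.2.1 = rotate b (o x.1) x.2.1 + 3.
Proof.
rewrite same_pinE => /and3P [/across_opposite [e' /eqP E <-] /eqP E' _].
by apply: dirvec_inj; move: E; rewrite E' => /addrI.
Qed.

Lemma same_pin_uniq (x y z : pin_name k.+2 S) :
  same_pin chi h x y -> same_pin chi h x z -> y = z.
Proof.
move=> xy xz; move: (same_pin_label xy) (same_pin_label xz).
move: xy xz; rewrite !same_pinE => /and3P [xy _ /eqP ry] /and3P [xz _ /eqP rz].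
case: y z ry rz xy xz => [v [e i]] [w [f j]] /= -> -> xv xw.
by rewrite (across_uniq xv xw) => <- /rotate_inj ->.
Qed.

Lemma on_bondE (u : S) (p : pin k.+2) :
  on_bond chi h (u, p) = [exists v, across u p.1 v].
Proof.
rewrite /on_bond /edge_dir /= chiE compassE.
apply/idP/existsP => [uS|[v /eqP <-]]; last exact: valP.
by exists [` uS]; rewrite /across.
Qed.

Lemma receptionE u p : [exists v, across u p.1 v] ->
  reception chi h u p = beeping chi h (u, p).
Proof.
rewrite /reception ffunE -on_bondE => up; apply: andb_idl => _.
by apply/existsP; exists (u, p); rewrite eqxx up; exact: connect0.
Qed.

(** Without wires a circuit is a single pin with its two names. Equal chiralities make rank
    [ord_max] at [u] rank [ord0] at the neighbor, so [u] hears the neighbor and never itself. *)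
Lemma reception_unwired u e :
  (forall v p p', ~~ wire (memory (h v)) p p') ->
  (forall v p, beep (memory (h v)) p -> p.2 = ord0) ->
  reception chi h u (e, ord_max) = [exists v, across u e v &&
    [exists e', (rotate b (o v) e' == rotate b (o u) e + 3) &&
                beep (memory (h v)) (e', ord0)]].
Proof.
move=> nowire beep0.
apply/idP/existsP => [|[v /andP [uv /existsP [e' /andP [/eqP ee' bv]]]]].
  rewrite ffunE => /andP [_ /existsP [y /andP [uy by_]]].
  (* [P] holds of the names of this pin. Only its invariance matters, so paths are mapped to a
     one-point type. *)
  pose P y := (y == (u, (e, ord_max))) || same_pin chi h (u, (e, ord_max)) y.
  have Pstep x z : P x -> same_pin chi h x z || wired h x z ->
      P z /\ connect (fun _ _ : unit => true) tt tt.
    rewrite /wired (negbTE (nowire _ _ _)) (negbTE (nowire _ _ _)) andbF orbF.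
    move=> /orP [/eqP -> xz|ux xz]; split=> //; first by rewrite /P xz orbT.
    by rewrite same_pin_sym in ux; rewrite /P (same_pin_uniq ux xz) eqxx.
  have [|Py _] := connect_image (f := fun=> tt) Pstep _ uy.
    by rewrite /P eqxx.
  case/orP: Py => [/eqP Ey|uy1]; first by have := beep0 _ _ by_; rewrite Ey.
  have := same_pin_label uy1; move: uy1; rewrite same_pinE /=.
  case: y by_ {uy} => [v [e' i]] /= bv /and3P [uv _ /eqP Ei] El.
  have i0 : i = ord0 by apply: val_inj; rewrite Ei /= subnn.
  by exists v; rewrite uv; apply/existsP; exists e'; rewrite El eqxx -i0.
rewrite receptionE; last by apply/existsP; exists v.
apply/existsP; exists (v, (e', ord0)); rewrite bv andbT.
apply: connect1; rewrite same_pinE /= uv.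
have [e2 vu] := across_opposite uv; rewrite -ee' => /rotate_inj <-.
by rewrite vu -val_eqE /= subnn eqxx.
Qed.

(** Wiring all pins on inner edges joins a region into one circuit. The disjunct [flag u] covers a
    region of one amoebot, which has no inner edge to listen on. *)
Lemma reception_region (flag : S -> bool) u :
  (forall v p p', wire (memory (h v)) p p' = inner v p.1 && inner v p'.1) ->
  (forall v p, beep (memory (h v)) p = flag v && inner v p.1) ->
  flag u || [exists p, inner u p.1 && reception chi h u p]
    = [exists v, reg u v && flag v].
Proof.
move=> wireE beepE.
have innerP v e : inner v e -> exists2 w, across v e w & o w = o v.
  by case/existsP => w /andP [? /eqP ?]; exists w.
have beeping_step x z : same_pin chi h x z || wired h x z ->
    beeping chi h z -> beeping chi h x.
  move=> xz /existsP [t /andP [zt bt]]; apply/existsP; exists t.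
  by rewrite bt andbT; apply: connect_trans zt; apply: connect1.
apply/orP/existsP => [[fu|]|[v /andP [uv fv]]].
- by exists u; rewrite fu andbT; exact: connect0.
- case/existsP=> p /andP [up]; rewrite ffunE => /andP [_].
  case/existsP=> y /andP [uy]; rewrite beepE => /andP [fy _].
  exists y.1; rewrite fy andbT.
  pose P (x : pin_name k.+2 S) := inner x.1 x.2.1.
  have Pstep x z : P x -> same_pin chi h x z || wired h x z ->
      P z /\ connect (fun u v => adjacent u v && (o u == o v)) x.1 z.1.
    rewrite /wired !wireE => Px /orP [|/andP [/eqP xz /orP wxz]]; last first.
      split; last by rewrite xz; exact: connect0.
      by rewrite /P -xz; case: wxz => /andP [].
    rewrite same_pinE => /and3P [xz zx _].
    have [w xw ow] := innerP _ _ Px; rewrite (across_uniq xw xz) in ow.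
    split; first by apply/existsP; exists x.1; rewrite zx ow eqxx.
    apply: connect1; rewrite ow eqxx andbT; apply/adjacentP.
    by exists x.2.1.
  by have [] := connect_image Pstep _ uy.
(* Stated so as to pass along a path in the region: the pin of rank [ord_max] at [u] is that of rank
   [ord0] at the next amoebot, where it is wired to all other inner pins. *)
suff [->|[e ue be]] : flag u \/
    exists2 e, inner u e & beeping chi h (u, (e, ord_max)).
- by left.
- right; apply/existsP; exists (e, ord_max); rewrite ue receptionE //.
  by have [w uw _] := innerP _ _ ue; apply/existsP; exists w.
case/connectP: uv fv => p pth -> {v}.
elim: p u pth => [|v p IH] u /=; first by left.
case/andP=> /andP [/adjacentP [e uv] /eqP ouv] pth fl; right.
have [e' vu _] := across_opposite uv.
have ue : inner u e by apply/existsP; exists v; rewrite uv ouv eqxx.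
have ve' : inner v e' by apply/existsP; exists u; rewrite vu ouv eqxx.
exists e => //; apply: (@beeping_step _ (v, (e', ord0))).
  by rewrite same_pinE /= uv vu -val_eqE /= subnn eqxx.
have [fv|[f vf bf]] := IH v pth fl.
  apply/existsP; exists (v, (e', ord0)); rewrite beepE /= fv ve' /same_circuit.
  by rewrite connect0.
by apply: beeping_step bf; rewrite /wired /= wireE eqxx ve' vf orbT.
Qed.

End Reception.

(** * The protocol *)

Section Protocol.

Variable k : nat.

Local Notation pin := (pin k.+2).

(** Slot of the phase, candidacy, toss, and the beeps received in each slot; all else is recomputed
    from these records. *)
Definition mem : finType :=
  ('I_15 * bool * bool * {ffun 'I_15 -> {ffun pin -> bool}})%type.

Implicit Types (q : mem) (e d : dir) (p : pin).

Definition slot q : 'I_15 := q.1.1.1.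
Definition cand q : bool := q.1.1.2.
Definition toss q : bool := q.1.2.
Definition heard q (j : nat) p : bool := q.2 (inord j) p.

(* In slot j < 6 the edges labelled j are announced; the label of the neighbor
   across e is hence read off the slot in which a beep arrives. *)
Definition rotated q e d := heard q (e - d + 3)%R (e, ord_max).

Definition inner_mem q e := rotated q e 0.

Definition region_heard q (j : nat) :=
  [exists p, inner_mem q p.1 && heard q j p].

Definition heads_mem q := (cand q && toss q) || region_heard q 6.

Definition facing_mem q d :=
  ~~ heads_mem q && [exists e, heard q 7 (e, ord_max) && rotated q e d].

Definition hit_mem q d := facing_mem q d || region_heard q (8 + d)%N.

Definition target_mem q : dir := odflt 0 [pick d | hit_mem q d].

Definition cand_mem q :=
  [&& cand q, heads_mem q ==> toss q & target_mem q == 0].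

(** The beeps read now were sent in the slot just ending, hence are filed under the old [slot q].
    The coin is used only when a phase starts. *)
Definition step_mem q (r : {ffun pin -> bool}) (x : bool) : mem :=
  if slot q == 14 :> nat then (ord0, cand_mem q, x, [ffun=> [ffun=> false]])
  else (inord (slot q).+1, cand q, toss q,
        [ffun j => if j == slot q then r else q.2 j]).

(** Applied to the memory after the step, so the turn takes place on entering slot 14, with slots 0
    to 13 recorded. *)
Definition turn_mem q : dir := if slot q == 14 :> nat then target_mem q else 0.

Definition region_slot (i : nat) := (i == 6)%N || (8 <= i < 14)%N.

Definition wire_mem q p p' :=
  [&& region_slot (slot q), inner_mem q p.1 & inner_mem q p'.1].

(* Slots 0 to 5 announce the edge labels; in slot 6 the candidates with heads
   beep in their regions, in slot 7 the regions with heads beep to their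
   neighbors, and in slot 8 + d a region without heads finds out whether it
   faces a region with heads whose compass is rotated by d.  The regions turn in
   slot 14. *)
Definition beep_mem q p : bool :=
  if (slot q < 6)%N then p == ((slot q)%:R, ord0)
  else if slot q == 6 :> nat then cand q && toss q && inner_mem q p.1
  else if slot q == 7 :> nat then heads_mem q && (p.2 == ord0)
  else if (slot q < 14)%N then
    facing_mem q (slot q - 8)%:R && inner_mem q p.1
  else false.

Lemma bool_gt0 : (0 < #|{: bool}|)%N.
Proof. by rewrite card_bool. Qed.

(* The initial state is that at the end of a phase in which everybody tossed
   heads, so that all amoebots are candidates at the start of the first one. *)
Definition align_protocol : protocol k.+2 :=
  Protocol ((inord 14, true, true, [ffun=> [ffun=> false]]) : mem)
    bool_gt0 step_mem turn_mem wire_mem beep_mem.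

(** * The protocol carries out the abstract phase *)

Section Run.

Variables (S : {fset node}) (chi : S -> bool) (b : bool).
Hypothesis chiE : forall u, chi u = b.

Local Notation adj := (@adjacent S).
Local Notation conf := (config align_protocol S).

Section Phase.

Variables (o : S -> dir) (c y : S -> bool).

(** The intended meaning of what is received in slot [i]. In the region slots the amoebot's own flag
    is added, as in [reception_region]; slot 14 is silent. *)
Definition sound (i : nat) (r : S -> pin -> bool) : Prop :=
  if (i < 6)%N then forall u e, r u (e, ord_max) =
    [exists v, across b o u e v &&
      (rotate b (o v) i%:R == rotate b (o u) e + 3)]
  else if i == 7 then forall u e, r u (e, ord_max) =
    [exists v, across b o u e v && heads adj o c y v]
  else if i == 6 then forall u,
    (c u && y u) || [exists p, inner b o u p.1 && r u p] = heads adj o c y u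
  else if (i < 14)%N then forall u,
    facing adj b o c y u (i - 8)%:R || [exists p, inner b o u p.1 && r u p]
      = hit adj b o c y u (i - 8)%:R
  else True.

Definition in_phase (i : nat) (m : S -> mem) : Prop := forall u,
  [/\ slot (m u) = i :> nat, cand (m u) = c u, toss (m u) = y u
    & forall j, (j < i)%N -> sound j (fun u => heard (m u) j)].

Section Memory.

Variables (i : nat) (m : S -> mem).
Hypothesis mP : in_phase i m.

(** The slot of the beep reveals the neighbor's label of the bond, which determines its compass by
    [opposite_label]. This requires slots 0 to 5 to be over. *)
Lemma rotated_phase u e d : (5 < i)%N ->
  rotated (m u) e d = [exists v, across b o u e v && (o v == rotate b (o u) d)].
Proof.
move=> i5; have lt6 := ltn_ord (e - d + 3).
have [_ _ _ /(_ (e - d + 3)%R) sj] := mP u.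
have {sj} := sj (leq_trans lt6 i5); rewrite /sound lt6 /rotated => ->.
by apply: eq_existsb => v; rewrite natr_Zp opposite_label.
Qed.

Lemma inner_phase u e : (5 < i)%N -> inner_mem (m u) e = inner b o u e.
Proof.
move=> i5; rewrite /inner_mem rotated_phase //.
by apply: eq_existsb => v; rewrite rotate0.
Qed.

Lemma region_heard_phase u j : (5 < i)%N ->
  region_heard (m u) j = [exists p, inner b o u p.1 && heard (m u) j p].
Proof. by move=> i5; apply: eq_existsb => p; rewrite inner_phase. Qed.

Lemma heads_phase u : (6 < i)%N -> heads_mem (m u) = heads adj o c y u.
Proof.
move=> i6; have [_ cu yu /(_ 6 i6)] := mP u.
rewrite /sound /= => /(_ u) <-.
by rewrite /heads_mem cu yu region_heard_phase // ltnW.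
Qed.

Lemma facing_phase u d : (7 < i)%N ->
  facing_mem (m u) d = facing adj b o c y u d.
Proof.
move=> i7; have [_ cu yu /(_ 7 i7)] := mP u.
rewrite /sound /= => s7; rewrite /facing_mem heads_phase 1?ltnW //.
congr (_ && _); apply/existsP/existsP => [[e]|[v]].
  rewrite s7 rotated_phase; last by rewrite 2?ltnW.
  (* Both beeps arrived over the same edge, hence from the same neighbor. *)
  case/andP=> /existsP [v /andP [uv hv]] /existsP [w /andP [uw ow]].
  exists v; rewrite hv (across_uniq uv uw) ow !andbT.
  by apply/(adjacentP b o); exists e.
case/andP=> /andP [/(adjacentP b o) [e uv] hv] ov; exists e.
rewrite s7 rotated_phase; last by rewrite 2?ltnW.
by apply/andP; split; apply/existsP; exists v; rewrite uv.
Qed.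

Lemma hit_phase u d : (13 < i)%N -> hit_mem (m u) d = hit adj b o c y u d.
Proof.
move=> i13; rewrite /hit_mem facing_phase; last by apply: leq_trans i13.
rewrite region_heard_phase; last by apply: leq_trans i13.
have lt6 := ltn_ord d; have lt14 : (8 + d < 14)%N by rewrite (ltn_add2l 8 d 6).
have [_ _ _ /(_ (8 + d)%N (leq_trans lt14 i13))] := mP u.
by rewrite /sound /= lt14 addKn natr_Zp => ->.
Qed.

Lemma target_phase u : (13 < i)%N -> target_mem (m u) = target adj b o c y u.
Proof.
move=> i13; congr odflt; apply: eq_pick => d; exact: hit_phase.
Qed.

Lemma cand_phase u : (13 < i)%N -> cand_mem (m u) = next_cand adj b o c y u.
Proof.
move=> i13; have [_ cu yu _] := mP u.
rewrite /cand_mem target_phase // heads_phase ?cu ?yu //.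
by apply: leq_trans i13.
Qed.

Lemma reception_phase (h : conf) : (i < 14)%N ->
  (forall u, memory (h u) = m u) -> (forall u, compass (h u) = o u) ->
  sound i (reception chi h).
Proof.
move=> i14 hm ho.
have wireE v p p' : wire (memory (h v)) p p' =
    [&& region_slot i, inner_mem (m v) p.1 & inner_mem (m v) p'.1].
  by have [<- _ _ _] := mP v; rewrite -hm.
have beepE v p : beep (memory (h v)) p =
    if (i < 6)%N then p == (i%:R, ord0)
    else if i == 6 then c v && y v && inner_mem (m v) p.1
    else if i == 7 then heads_mem (m v) && (p.2 == ord0)
    else if (i < 14)%N then
      facing_mem (m v) (i - 8)%:R && inner_mem (m v) p.1
    else false.
  by have [<- <- <- _] := mP v; rewrite -hm.
rewrite /sound; case: ltnP => [i6|i6].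
  move=> u e; rewrite (reception_unwired (b := b) (o := o)) //.
  - apply: eq_existsb => v; congr (_ && _).
    apply/existsP/idP => [[e' /andP [ee']]|ee'].
      by rewrite beepE i6 xpair_eqE eqxx andbT => /eqP <-.
    by exists i%:R; rewrite ee' beepE i6 eqxx.
  - by move=> v p p'; rewrite wireE /region_slot; lia.
  - by move=> v p; rewrite beepE i6 => /eqP ->.
case: eqP => [i7|i7].
  have beep7 v p : beep (memory (h v)) p = heads_mem (m v) && (p.2 == ord0).
    by rewrite beepE i7.
  move=> u e.
  rewrite (reception_unwired (b := b) (o := o)) //.
  - apply: eq_existsb => v; case uv: (across _ _ _ _ _);
      rewrite ?andFb // !andTb.
    have [e' _ Ee'] := across_opposite uv.
    apply/existsP/idP => [[f /andP [_]]|hv].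
      by rewrite beep7 heads_phase ?i7 // => /andP [].
    by exists e'; rewrite Ee' eqxx beep7 heads_phase ?i7 // hv eqxx.
  - by move=> v p p'; rewrite wireE /region_slot i7.
  - by move=> v p; rewrite beep7 => /andP [_ /eqP].
have wireR v p p' : wire (memory (h v)) p p' =
    inner b o v p.1 && inner b o v p'.1.
  by rewrite wireE !inner_phase // /region_slot;
    have -> // : (i == 6) || (8 <= i < 14)%N by lia.
case: eqP => [i6'|i6'].
  pose flag v := c v && y v.
  move=> u; apply: (reception_region chiE ho (flag := flag)) => //.
  by move=> v p; rewrite beepE i6' /= inner_phase ?i6'.
rewrite i14 => u; set d := (i - 8)%:R; pose flag v := facing adj b o c y v d.
have i8 : (7 < i)%N by lia.
apply: (reception_region chiE ho (flag := flag)) => //.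
move=> v p; rewrite beepE ltnNge i6 (introF eqP i6') (introF eqP i7) i14.
by rewrite facing_phase // inner_phase.
Qed.

End Memory.

Lemma eq_sound i r r' : (forall u p, r u p = r' u p) -> sound i r -> sound i r'.
Proof.
move=> E; have Eex u : [exists p, inner b o u p.1 && r u p]
    = [exists p, inner b o u p.1 && r' u p].
  by apply: eq_existsb => p; rewrite E.
rewrite /sound; case: ifP => _; first by move=> s u e; rewrite -E.
case: ifP => _; first by move=> s u e; rewrite -E.
case: ifP => _; first by move=> s u; rewrite -Eex.
by case: ifP => _ // s u; rewrite -Eex.
Qed.

(** The beeps of slot [i] are still in [received] and enter the memory one round later; compasses
    change only at slot 14. *)
Definition phase_at (i : nat) (g : conf) : Prop :=
  in_phase i (fun u => memory (g u)) /\
  if (i < 14)%N then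
    (forall u, compass (g u) = o u) /\ sound i (fun u => received (g u))
  else forall u, compass (g u) = next_compass adj b o c y u.

Lemma phase_round i (g : conf) (w : {ffun S -> bool}) : (i < 15)%N ->
  in_phase i (fun u => step_mem (memory (g u)) (received (g u)) (w u)) ->
  (forall u, compass (g u) = o u) -> phase_at i (round chi g w).
Proof.
move=> i15 mP go; split; first exact: mP.
case: ltnP => i14.
  have ho u : compass (activate chi g w u) = o u.
    have [si _ _ _] := mP u.
    by rewrite /= go /turn_mem si ltn_eqF // rotate0.
  by split=> //; apply: (reception_phase mP).
move=> u /=; have [si _ _ _] := mP u; rewrite go chiE /turn_mem si.
by rewrite (_ : i = 14) ?(target_phase mP) //; lia.
Qed.

Lemma phase_step i (g : conf) (w : {ffun S -> bool}) : (i < 14)%N ->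
  phase_at i g -> phase_at i.+1 (round chi g w).
Proof.
rewrite /phase_at => i14 [mP]; rewrite i14 => -[go gs].
apply: phase_round => // u.
have [si ci ti sj] := mP u; rewrite /step_mem si ltn_eqF //.
split=> //; first by rewrite /slot /= inordK.
move=> j; rewrite ltnS leq_eqVlt => /orP [/eqP ->|ji].
  apply: eq_sound gs => v p; have [sv _ _ _] := mP v.
  rewrite sv ltn_eqF // /heard /= ffunE -val_eqE /= sv inordK ?eqxx //.
  exact: ltnW.
apply: eq_sound (sj j ji) => v p; have [sv _ _ _] := mP v.
rewrite sv ltn_eqF // /heard /= ffunE -val_eqE /= sv inordK; last by lia.
by rewrite ltn_eqF.
Qed.

End Phase.

(** * Whole phases, persistence of alignment, and the expected number of candidates *)

Definition ready (g : conf) := forall u, slot (memory (g u)) = 14 :> nat.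

(** Candidacy for the coming phase; the stored bit is updated only in its first round. *)
Definition candidate (g : conf) u := cand_mem (memory (g u)).

Lemma phase_start (g : conf) (w : {ffun S -> bool}) : ready g ->
  phase_at (fun u => compass (g u)) (candidate g) w 0 (round chi g w).
Proof.
move=> rg; apply: phase_round => // u.
by rewrite /step_mem rg.
Qed.

Lemma phase_prefix (g : conf) (x : {ffun S -> bool}) ws : ready g ->
  (size ws <= 14)%N ->
  phase_at (fun u => compass (g u)) (candidate g) x (size ws)
    (foldl (round chi) g (x :: ws)).
Proof.
move=> rg; elim/last_ind: ws => [|ws w IH] /=.
  by move=> _; exact: phase_start.
rewrite size_rcons => ws14; rewrite foldl_rcons.
by apply: phase_step => //; apply: IH; exact: ltnW.
Qed.

(** The outcome depends only on [x], the tosses of the first round; those of the other 14 rounds are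
    ignored. *)
Lemma phase_end (g : conf) (x : {ffun S -> bool}) ws : ready g ->
  size ws = 14 ->
  let g' := foldl (round chi) g (x :: ws) in
  let o u := compass (g u) in
  [/\ ready g',
      forall u, compass (g' u) = next_compass adj b o (candidate g) x u
    & forall u, candidate g' u = next_cand adj b o (candidate g) x u].
Proof.
move=> rg ws14 g' o; have := phase_prefix x rg (eq_leq ws14).
rewrite ws14 -/g' => -[mP /= gc]; split=> // u; first by have [] := mP u.
exact: (cand_phase mP).
Qed.

(** Alignment strengthened to an invariant of single rounds, since it must persist in the middle of
    a phase as well. *)
Definition steady d (g : conf) : Prop :=
  (ready g /\ forall u, compass (g u) = d) \/
  exists i o c y, [/\ (i < 14)%N, phase_at o c y i g & forall u, o u = d].

Lemma steady_compass d g : steady d g -> forall u, compass (g u) = d.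
Proof.
case=> [[] //|[i [o [c [y [i14 [_]]]]]]]; rewrite i14 => -[go _] od u.
by rewrite go.
Qed.

Lemma steady_round d g (w : {ffun S -> bool}) :
  steady d g -> steady d (round chi g w).
Proof.
case=> [[rg gd]|[i [o [c [y [i14 gi od]]]]]].
  right; do 4!eexists; split; [|exact: phase_start|exact: gd].
  by [].
have [i13|i13] := ltnP i.+1 14.
  by right; exists i.+1, o, c, y; split=> //; exact: phase_step.
have := phase_step w i14 gi; rewrite /phase_at ltnNge i13 => -[mP gc].
left; split=> u; first by have [-> _ _ _] := mP u; lia.
by rewrite gc; apply: next_compass_aligned od; exact: adjacent_sym.
Qed.

Lemma steady_run d g (ws : seq {ffun S -> bool}) :
  steady d g -> steady d (foldl (round chi) g ws).
Proof. by elim: ws g => //= w ws IH g /(steady_round w) /IH. Qed.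

Hypothesis conn : structure_connected S.

Definition aligned (g : conf) : bool :=
  [forall u, forall v, compass (g u) == compass (g v)].

(** Set to [0] on alignment; otherwise at least [1] in a configuration that is [led], as Markov's
    inequality requires. *)
Definition potential (g : conf) : nat :=
  if aligned g then 0 else #|candidate g|.

Definition led (g : conf) : Prop := ready g /\
  forall u, exists2 v, region adj (fun u => compass (g u)) u v & candidate g v.

Lemma led_phase (g : conf) ws : led g -> size ws = 15 ->
  led (foldl (round chi) g ws).
Proof.
case: ws => [//|x ws] [rg inv] [ws14].
have [rg' gc' gd'] := phase_end x rg ws14; split=> // u.
have [v uv cv] := next_cand_region b (@adjacent_sym S) x inv u.
exists v; last by rewrite gd'.
apply: connect_sub uv => a a' aa'; apply: connect1.
by rewrite !gc'.
Qed.

(** Linearity of expectation: after exchanging the sums, each candidate survives at most 3/4 of the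
    tosses. *)
Lemma sum_next_cand (o : S -> dir) (c : pred S) u0 w0 : o u0 != o w0 ->
  (forall u, exists2 v, region adj o u v & c v) ->
  (4 * \sum_(x : {ffun S -> bool}) #|next_cand adj b o c x|
    <= 3 * (#|{ffun S -> bool}| * #|c|))%N.
Proof.
move=> ou0 inv.
under eq_bigr => x _ do rewrite -sum1_card big_mkcond.
rewrite exchange_big big_distrr /= mulnA -[#|c|]sum1_card big_distrr /=.
rewrite [leqRHS]big_mkcond.
apply: leq_sum => u _; rewrite -big_mkcond sum1_card muln1.
case: ifP => cu; last first.
  rewrite eq_card0 // => x; rewrite !inE /next_cand.
  by rewrite -[c u]/(u \in c) cu.
have [w ow] : exists w, o u != o w.
  have [uu0|] := eqVneq (o u) (o u0); last by exists u0.
  by exists w0; rewrite uu0.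
have [v vu dead] := next_cand_witness b (@adjacent_sym S) conn inv ow.
have uv : u != v by rewrite eq_sym.
rewrite -(card_ffun_bool2 uv) leq_mul2l; apply: subset_leq_card.
apply/subsetP => x; rewrite !inE; apply: contraTN => /andP [xu xv].
exact: dead.
Qed.

Lemma led_phases m (g : conf) ws : led g -> size ws = (m * 15)%N ->
  led (foldl (round chi) g ws).
Proof.
elim: m ws g => [|m IH] ws g lg; first by move/size0nil ->.
rewrite mulSn => wsz; rewrite -(cat_take_drop 15 ws) foldl_cat.
apply: IH; last by rewrite size_drop wsz addKn.
by apply: led_phase => //; rewrite size_takel // wsz leq_addr.
Qed.

(** An aligned configuration stays aligned, with potential [0]. Otherwise the surviving candidates
    bound the new potential, and the 14 ignored rounds give a constant factor. *)
Lemma drift (g : conf) : led g ->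
  (4 * seqsum 15 (fun ws => potential (foldl (round chi) g ws))
    <= 3 * (#|{ffun S -> bool}| ^ 15 * potential g))%N.
Proof.
move=> [rg inv]; rewrite {2}/potential.
case: ifPn => [/forallP al|].
  rewrite (@eq_seqsum _ _ _ (fun=> 0%N)) ?seqsum_const ?muln0 // => ws _.
  suff -> : potential (foldl (round chi) g ws) = 0%N by [].
  rewrite /potential; case: ifPn => // /forallPn [u /forallPn [v]].
  have st : steady (compass (g u)) g.
    by left; split=> // w; apply/eqP; move/forallP: (al w).
  by rewrite !(steady_compass (steady_run ws st)) eqxx.
move=> /forallPn [u /forallPn [v uv]].
apply: (@leq_trans (4 * \sum_(x : {ffun S -> bool}) #|{ffun S -> bool}| ^ 14 *
    #|next_cand adj b (fun u => compass (g u)) (candidate g) x|)%N).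
  rewrite seqsumS leq_mul2l; apply/orP; right; apply: leq_sum => x _.
  rewrite -seqsum_const.
  apply: leq_seqsum => ws ws14.
  have [_ _ cand'] := phase_end x rg ws14.
  rewrite -(eq_card cand') /potential; case: ifP => // _.
rewrite -big_distrr /= mulnCA (expnSr _ 14) -[(_ ^ 14 * _ * _)%N]mulnA.
by rewrite [leqRHS]mulnCA leq_mul2l (sum_next_cand uv inv) orbT.
Qed.

Lemma initial_led (o : S -> dir) : led (initial align_protocol o).
Proof.
have cand1 u : candidate (initial align_protocol o) u.
  rewrite /candidate /cand_mem /heads_mem /cand /toss /=.
  rewrite /target_mem; case: pickP => //= d.
  rewrite /hit_mem /facing_mem /heads_mem /=.
  by case/existsP=> p; rewrite /heard /= !ffunE andbF.
split=> u; first by rewrite /slot /= inordK.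
by exists u => //; exact: connect0.
Qed.

Lemma steady_aligned d (g : conf) ws (t0 : nat) :
  steady d (foldl (round chi) g (take t0 ws)) ->
  forall t, (t0 <= t)%N -> forall u,
  compass (foldl (round chi) g (take t ws) u) = d.
Proof.
move=> st t tt u; apply: steady_compass.
rewrite -(subnKC tt) takeD foldl_cat; exact: steady_run.
Qed.

(** Markov's inequality: a run that fails has potential at least [1] after [m] phases. The last [r]
    rounds preserve alignment and only contribute a factor. *)
Lemma misaligned_count (o : S -> dir) m r :
  (4 ^ m * #|[pred w : choices align_protocol S (m * 15 + r) |
              ~~ aligned_from chi o (m * 15) w]|
    <= 3 ^ m * (#|{ffun S -> bool}| ^ (m * 15 + r) *
                potential (initial align_protocol o)))%N.
Proof.
set g0 := initial _ o; set P := [pred w | _].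
pose F (ws : seq {ffun S -> bool}) :=
  potential (foldl (round chi) g0 (take (m * 15) ws)).
have PF : (#|P| <= \sum_(w : choices align_protocol S (m * 15 + r)) F w)%N.
  rewrite -sum1_card big_mkcond; apply: leq_sum => w _; case: ifP => // Pw.
  have inv : led (foldl (round chi) g0 (take (m * 15) w)).
    apply: led_phases (initial_led o) _.
    by rewrite size_takel // size_tuple leq_addr.
  rewrite /F /potential; case: ifPn => [/forallP al|/forallPn [u _]];
    last by have [v _ cv] := inv.2 u; apply/card_gt0P; exists v.
  have [e Ee] : exists e, forall u,
      compass (foldl (round chi) g0 (take (m * 15) w) u) = e.
    have [u0 _|S0] := pickP (xpredT : pred S);
      last by exists 0 => u; have := S0 u.
    by exists (compass (foldl (round chi) g0 (take (m * 15) w) u0)) => u;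
      apply/eqP; move/forallP: (al u).
  case/negP: Pw; apply/existsP; exists e; apply/forallP => t.
  apply/implyP => tt; apply/forallP => u; apply/eqP; apply: steady_aligned tt u.
  by left; split=> //; exact: inv.1.
apply: leq_trans (leq_mul (leqnn _) PF) _.
rewrite (sum_tuple _ F) seqsum_cat.
rewrite (@eq_seqsum _ _ _ (fun ws => #|{ffun S -> bool}| ^ r *
    potential (foldl (round chi) g0 ws))%N); last first.
  move=> ws wsz; rewrite -seqsum_const; apply: eq_seqsum => s _.
  by rewrite /F take_size_cat.
rewrite seqsum_mull expnD mulnCA mulnAC [leqRHS]mulnA [leqRHS]mulnC leq_mul2l.
apply/orP; right.
by apply: (drift_phases led_phase drift); exact: initial_led.
Qed.

End Run.
End Protocol.

(** * The high probability bound *)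

Theorem theorem3p4 (k : nat) (hk : (2 <= k)%N) :
  exists A : protocol k,
  forall c : nat, exists K : nat,
  forall (S : {fset node}) (chi : S -> bool) (o : S -> dir),
    structure_connected S ->
    (forall u v : S, chi u = chi v) ->
    forall T : nat, (K * up_log 2 #|` S| <= T)%N ->
      1 - 1 / (#|` S|%:R ^+ c)
        <= Pr (fun w : choices A S T =>
                 aligned_from chi o (K * up_log 2 #|` S|) w).
Proof.
case: k hk => [|[|k]] // _; exists (align_protocol k) => c.
(* Three phases shrink the expectation to 27/64, less than a half, so [3 * c.+1 * l] phases bring it
   from at most [n] down to at most [n / n ^ c.+1]. A phase has 15 rounds. *)
exists (3 * c.+1 * 15)%N => S chi o conn chiE T.
have [b chib] : exists b, forall u, chi u = b.
  have [u0 _|S0] := pickP (xpredT : pred S);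
    last by exists true => u; have := S0 u.
  by exists (chi u0) => u; apply: chiE.
set n := #|` S|; set l := up_log 2 n => KT.
set m := (3 * c.+1 * l)%N.
have EK : (3 * c.+1 * 15 * l = m * 15)%N by rewrite mulnAC.
move: KT; rewrite EK => mT; rewrite -(subnKC mT).
set r := (T - m * 15)%N; have := @misaligned_count k S chi b chib conn o m r.
set P := [pred w | _]; set N := #|{ffun S -> bool}|.
set g0 := initial _ o => cP.
have N_gt0 : (0 < N)%N by rewrite /N card_ffun card_bool expn_gt0.
have cardW :
    #|choices (align_protocol k) S (m * 15 + r)| = (N ^ (m * 15 + r))%N.
  exact: card_tuple.
have n4m : (n ^ c.+1 * 3 ^ m <= 4 ^ m)%N.
  apply: (@leq_trans ((2 ^ l) ^ c.+1 * 3 ^ m)%N).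
    by rewrite leq_mul2r leq_exp2r // up_logP // orbT.
  rewrite /m -expnM [(l * _)%N]mulnC -mulnA !(expnM _ 3) -expnMn.
  (* This is the inequality [2 * 3 ^ 3 <= 4 ^ 3] raised to the power [c.+1 * l]. *)
  have [->//|cl] := posnP (c.+1 * l); by rewrite leq_exp2r.
have pot_le : (potential g0 <= n)%N.
  by rewrite /potential /n cardfE; case: ifP => // _; exact: max_card.
(* For the empty structure and positive [c] the allowed failure probability is [1 / 0 = 0], so no
   run may fail at all. *)
have P0 : n = 0%N -> #|P| = 0%N.
  move=> n0; move: pot_le cP; rewrite n0 leqn0 => /eqP ->.
  by rewrite !muln0 leqn0 muln_eq0 expn_eq0 /= => /eqP.
have bound : (n ^ c * #|P| <= N ^ (m * 15 + r))%N.
  have [n0|n_gt0] := posnP n; first by rewrite P0 // muln0.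
  rewrite -(@leq_pmul2l (n * 3 ^ m)) ?muln_gt0 ?n_gt0 ?expn_gt0 //.
  have -> : (n * 3 ^ m * (n ^ c * #|P|) = n ^ c.+1 * 3 ^ m * #|P|)%N.
    by rewrite expnS; ring.
  apply: leq_trans (leq_mul n4m (leqnn _)) _; apply: leq_trans cP _.
  by rewrite (mulnC n) -mulnA (mulnC n) !leq_mul2l pot_le !orbT.
have W_gt0 : 0 < (N ^ (m * 15 + r))%:R :> rat.
  by rewrite ltr0n expn_gt0 N_gt0.
rewrite /Pr cardW; set a := #|_|.
have -> : a%:R / (N ^ (m * 15 + r))%:R
    = 1 - #|P|%:R / (N ^ (m * 15 + r))%:R :> rat.
  have EW : (a + #|P| = N ^ (m * 15 + r))%N.
    by rewrite -cardW -(cardC [pred w | aligned_from chi o (m * 15) w]).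
  apply: (mulIf (lt0r_neq0 W_gt0)); rewrite mulrBl !divfK ?lt0r_neq0 //.
  by rewrite mul1r -EW natrD addrK.
rewrite lerB // ler_pdivrMr //.
have [n0|n_gt0] := posnP n.
  by rewrite P0 // mul1r mulr_ge0 ?invr_ge0 ?exprn_ge0 ?ler0n.
rewrite mul1r mulrC ler_pdivlMr ?exprn_gt0 ?ltr0n //.
by rewrite mulrC -natrX -natrM ler_nat.
Qed.
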